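(* Let $D$ be a double vector bundle with side bundles $A\to M$ and $B\to M$ and core $C\to M$. Let $(\xi,X)$ and $(\eta,Y)$ be linear sections forming a grid on $D$, where $X\in\Gamma A$, $\xi\in\Gamma_B D$, $Y\in\Gamma B$ and $\eta\in\Gamma_A D$. Let $w(\xi,\eta)\in\Gamma C$ be the warp of the grid, and let $\xi^{\sqcap}\in\Gamma_{C^*}\big((D^{*B})^{*C^*}\big)$ and $\eta^{\sqcap}\in\Gamma_{C^*}\big((D^{*A})^{*C^*}\big)$ be the corresponding squarecap sections. Then, as functions on $C^*$, $$\langle\!\langle \xi^{\sqcap},\eta^{\sqcap}\rangle\!\rangle=\ell_{-w(\xi,\eta)},$$ that is, $\langle\!\langle \xi^{\sqcap}(\kappa),\eta^{\sqcap}(\kappa)\rangle\!\rangle=-\langle\kappa,\,w(\xi,\eta)(m)\rangle$ for all $m\in M$ and $\kappa\in C^*_m$. Here $\langle\!\langle\ ,\ \rangle\!\rangle$ is the pairing of $(D^{*B})^{*C^*}$ with $(D^{*A})^{*C^*}$ over $C^*$ defined by $\langle\!\langle\mathcal{B},\mathcal{A}\rangle\!\rangle=\langle\mathcal{A},R^D_A(\mathcal{B})\rangle_{C^*}$.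
   Context: **Double vector bundles.** A double vector bundle $D$ with side bundles $A\to M$ and $B\to M$ (smooth vector bundles over a manifold $M$) is a manifold $D$ with two vector bundle structures $D\to A$ and $D\to B$, such that each of the four structure maps (bundle projection, addition, scalar multiplication, zero section) of either structure is a morphism of vector bundles with respect to the other structure, and such that $D\to A\times_M B$ is a surjective submersion. Write $+_A,-_A$ for addition and subtraction in the fibres of $D\to A$ and $+_B,-_B$ for those in the fibres of $D\to B$. Write $\tilde 0^A_a$ for the zero of $D\to A$ over $a\in A$ and $\tilde 0^B_b$ for the zero of $D\to B$ over $b\in B$. The core $C$ is the set of elements of $D$ that project to zeros in both $A$ and $B$; the two additions coincide on $C$ and make it a vector bundle over $M$. If $d,d'\in D$ project to the same $a\in A$ and the same $b\in B$, there is a unique $c\in C$ with $d-_A d'=c+_B\tilde 0^A_a$ and $d-_B d'=c+_A\tilde 0^B_b$. **Duals.** $D^{*A}$ is the usual dual of the vector bundle $D\to A$, with pairing $\langle\ ,\ \rangle_A$. It is a double vector bundle with side bundles $A$ and $C^*$ and core $B^*$, as follows. - Projection to $C^*$: an element $\Phi\in D^{*A}$ over $a\in A_m$ projects to $\kappa\in C^*_m$, where $\langle\kappa,c\rangle=\langle\Phi,\tilde 0^A_a+_B c\rangle_A$ for $c\in C_m$. - Addition over $C^*$: if $\Phi,\Phi'$ lie over $a,a'$ and the same $\kappa$, then $\langle\Phi+_{C^*}\Phi',\,d+_B d'\rangle_A=\langle\Phi,d\rangle_A+\langle\Phi',d'\rangle_A$ for all $d,d'\in D$ over $a,a'$ respectively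 and over a common $b\in B$. Scalar multiplication over $C^*$ is defined analogously, and the zero over $\kappa\in C^*_m$ lies over $0\in A_m$ and is given by $\tilde 0^B_b+_A c\mapsto\langle\kappa,c\rangle$. - Core: $\beta\in B^*_m$ corresponds to the element of $D^{*A}$ over $0\in A_m$ given by $\tilde 0^B_b+_A c\mapsto\langle\beta,b\rangle$. Interchanging the roles of $A$ and $B$, the dual $D^{*B}$ of $D\to B$, with pairing $\langle\ ,\ \rangle_B$, is a double vector bundle with side bundles $B$ and $C^*$ and core $A^*$. The iterated duals $(D^{*A})^{*C^*}$ and $(D^{*B})^{*C^*}$ are the duals of the vector bundles $D^{*A}\to C^*$ and $D^{*B}\to C^*$. Their pairings with $D^{*A}$ and $D^{*B}$ respectively are both denoted $\langle\ ,\ \rangle_{C^*}$. By the same construction $(D^{*A})^{*C^*}$ has side bundles $C^*$ and $B$, and $(D^{*B})^{*C^*}$ has side bundles $C^*$ and $A$. **The map $R^D_A$.** There is an isomorphism of double vector bundles $R^D_A\colon (D^{*B})^{*C^*}\to D^{*A}$, inducing the identity on the side bundles $A$ and $C^*$ and $-\mathrm{id}$ on the cores $B^*$. It is characterized by $$\langle\mathcal{B},\Psi\rangle_{C^*}+\langle R^D_A(\mathcal{B}),d\rangle_A=\langle\Psi,d\rangle_B$$ for all $\mathcal{B}\in(D^{*B})^{*C^*}$, $\Psi\in D^{*B}$, $d\in D$ for which the pairings are defined (i.e. $\mathcal{B},\Psi$ lie over the same element of $C^*$; $R^D_A(\mathcal{B}),d$ over the same element of $A$; $\Psi,d$ over the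 same element of $B$). **The pairing.** For $\mathcal{B}\in(D^{*B})^{*C^*}$ and $\mathcal{A}\in(D^{*A})^{*C^*}$ over the same $\kappa\in C^*$, set $\langle\!\langle\mathcal{B},\mathcal{A}\rangle\!\rangle:=\langle\mathcal{A},R^D_A(\mathcal{B})\rangle_{C^*}$. For sections of the two bundles over $C^*$ the pairing is taken pointwise, giving a function on $C^*$. **Linear sections, grids, warps.** $\Gamma_A D$ and $\Gamma_B D$ denote the sections of $D\to A$ and $D\to B$. A linear section $(\xi,X)$ of $D\to B$ consists of $X\in\Gamma A$ and $\xi\in\Gamma_B D$ such that $\xi\colon B\to D$ is a morphism of vector bundles from $B\to M$ to $D\to A$ over $X\colon M\to A$. A linear section $(\eta,Y)$ of $D\to A$ consists of $Y\in\Gamma B$ and $\eta\in\Gamma_A D$ such that $\eta\colon A\to D$ is a morphism of vector bundles from $A\to M$ to $D\to B$ over $Y\colon M\to B$. A grid on $D$ is a pair of linear sections $(\xi,X)$, $(\eta,Y)$ of these two kinds. For each $m\in M$, $\xi(Y(m))$ and $\eta(X(m))$ both project to $X(m)\in A$ and $Y(m)\in B$. The warp of the grid is the section $w(\xi,\eta)\in\Gamma C$ determined by $$\xi(Y(m))-_A\eta(X(m))=w(\xi,\eta)(m)+_B\tilde 0^A_{X(m)},\qquad \xi(Y(m))-_B\eta(X(m))=w(\xi,\eta)(m)+_A\tilde 0^B_{Y(m)}.$$ **Squarecap sections.** For a linear section $(\eta,Y)$ of $D\to A$, the squarecap section $\eta^{\sqcap}$ of $(D^{*A})^{*C^*}\to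 C^*$ is defined by $\langle\eta^{\sqcap}(\kappa),\Phi\rangle_{C^*}=\langle\Phi,\eta(a)\rangle_A$ for every $\kappa\in C^*$ and every $\Phi\in D^{*A}$ over $\kappa$, where $a\in A$ is the projection of $\Phi$ to $A$. The right-hand side is linear in $\Phi$ with respect to $D^{*A}\to C^*$. Similarly, for a linear section $(\xi,X)$ of $D\to B$, the squarecap section $\xi^{\sqcap}$ of $(D^{*B})^{*C^*}\to C^*$ is defined by $\langle\xi^{\sqcap}(\kappa),\Psi\rangle_{C^*}=\langle\Psi,\xi(b)\rangle_B$ for every $\Psi\in D^{*B}$ over $\kappa$, where $b\in B$ is the projection of $\Psi$ to $B$. **Linear functions.** For $c\in\Gamma C$, $\ell_c\colon C^*\to\mathbb{R}$ is the function $\ell_c(\kappa)=\langle\kappa,c(m)\rangle$ for $\kappa\in C^*_m$. *)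

(* Defs.v *)
From HB Require Import structures.
From mathcomp Require Import all_boot all_order all_algebra.
From mathcomp Require Import all_classical all_reals all_analysis.
Import Order.TTheory GRing.Theory Num.Theory.
Import numFieldNormedType.Exports.

Set Implicit Arguments.
Unset Strict Implicit.
Unset Printing Implicit Defensive.

Local Open Scope classical_set_scope.
Local Open Scope ring_scope.

(* Used for objects determined by a characterizing property P; x0 is a junk
   value for the case where nothing satisfies P. *)
Definition the {T : Type} (x0 : T) (P : set T) : T := @xget {classic T} x0 P.

Section EuclideanSmoothness.
Variable R : realType.

(* f is of class C^k on U: all partial derivatives of order <= k exist and
   are continuous at the points of U (meant for open U). *)
Fixpoint class_C (k n : nat) (U : set 'rV[R]_n) (f : 'rV[R]_n -> R) : Prop :=
  {in U, continuous f} /\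
  match k with
  | 0 => True
  | k'.+1 => forall i : 'I_n,
      {in U, forall x, derivable f x (delta_mx 0 i)} /\
      class_C k' U (fun x => 'D_(delta_mx 0 i) f x)
  end.

Definition smooth_vec (n p : nat) (U : set 'rV[R]_n)
    (f : 'rV[R]_n -> 'rV[R]_p) : Prop :=
  forall (k : nat) (j : 'I_p), class_C k U (fun x => f x 0 j).

End EuclideanSmoothness.

Record chart (R : realType) (X : Type) (n : nat) := Chart {
  cdom : set X;
  cfwd : X -> 'rV[R]_n;
  cbwd : 'rV[R]_n -> X  (* relevant on cfwd @` cdom only *)
}.

(* A space with a family of charts; the axioms are in [is_manifold], so that
   products can be formed without proof obligations. *)
Record charted (R : realType) := Charted {
  cspace :> topologicalType;
  cdim : nat;
  atlas : set (chart R cspace cdim)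
}.
Arguments atlas {R} c.

Section Manifolds.
Variable R : realType.
Implicit Types X Y N : charted R.

Definition is_chart (X : topologicalType) (n : nat) (c : chart R X n) : Prop :=
  [/\ open (cdom c), open (cfwd c @` cdom c),
      {in cdom c, cancel (cfwd c) (cbwd c)},
      {in cdom c, continuous (cfwd c)} &
      {in cfwd c @` cdom c, continuous (cbwd c)}].

Definition compatible_charts (X : Type) (n : nat) (c c' : chart R X n) : Prop :=
  smooth_vec (cfwd c @` (cdom c `&` cdom c')) (cfwd c' \o cbwd c).

Definition is_manifold X : Prop :=
  [/\ hausdorff_space X, @second_countable X,
      forall c, atlas X c -> is_chart c,
      forall x : X, exists2 c, atlas X c & cdom c x &
      forall c c', atlas X c -> atlas X c' -> compatible_charts c c'].

Definition coord_map X Y (c : chart R X (cdim X)) (c' : chart R Y (cdim Y))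
  (f : X -> Y) : 'rV[R]_(cdim X) -> 'rV[R]_(cdim Y) := cfwd c' \o f \o cbwd c.

(* Meant for open U. *)
Definition smooth_open X Y (U : set X) (f : X -> Y) : Prop :=
  {in U, continuous f} /\
  forall c c', atlas X c -> atlas Y c' ->
    smooth_vec (cfwd c @` (U `&` cdom c `&` f @^-1` cdom c')) (coord_map c c' f).

(* Smoothness on an arbitrary subset S: local extendability to smooth maps on
   open sets. For S an embedded submanifold (below: fibred products) this is
   smoothness for the submanifold structure. *)
Definition smooth_on X Y (S : set X) (f : X -> Y) : Prop :=
  forall x, S x -> exists U : set X, exists g : X -> Y,
    [/\ open U, U x, smooth_open U g & {in S `&` U, f =1 g}].

Definition smooth X Y (f : X -> Y) : Prop := smooth_on setT f.

Definition prod_chart (X Y : Type) (n p : nat) (c : chart R X n)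
    (c' : chart R Y p) : chart R (X * Y) (n + p) :=
  Chart (cdom c `*` cdom c')
        (fun z => row_mx (cfwd c z.1) (cfwd c' z.2))
        (fun v => (cbwd c (lsubmx v), cbwd c' (rsubmx v))).

Definition cprod X Y : charted R :=
  @Charted R (X * Y)%type (cdim X + cdim Y)
    [set e | exists c c',
       [/\ atlas X c, atlas Y c' & e = prod_chart c c']].

Definition euclid (k : nat) : charted R :=
  @Charted R 'rV[R]_k k [set Chart setT id id].

(* The matrix (acting on row vectors from the right) of the tangent map of f
   at x in the coordinates given by c and c'. *)
Definition tangent_mx X Y (c : chart R X (cdim X)) (c' : chart R Y (cdim Y))
    (f : X -> Y) (x : X) : 'M[R]_(cdim X, cdim Y) :=
  'J (coord_map c c' f) (cfwd c x).

End Manifolds.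

(* Projection, zero section and fibrewise operations of a vector bundle E -> N.
   [vadd] is total; its value is irrelevant on elements of distinct fibres. *)
Record vbstr (R : realType) (E N : Type) := VBStr {
  vproj : E -> N;
  vzero : N -> E;
  vadd : E -> E -> E;
  vscale : R -> E -> E
}.

Section VectorBundles.
Variable R : realType.

Section Algebra.
Variables (E N : Type) (V : vbstr R E N).

Definition vopp (e : E) : E := vscale V (-1) e.
Definition vsub (e e' : E) : E := vadd V e (vopp e').

Definition vector_fibres : Prop :=
  [/\ forall n, vproj V (vzero V n) = n,
      forall e e', vproj V e = vproj V e' -> vproj V (vadd V e e') = vproj V e,
      forall t e, vproj V (vscale V t e) = vproj V e &
      [/\ forall e e' e'', vproj V e = vproj V e' -> vproj V e' = vproj V e'' ->
            vadd V e (vadd V e' e'') = vadd V (vadd V e e') e'',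
          forall e e', vproj V e = vproj V e' -> vadd V e e' = vadd V e' e,
          forall e, vadd V (vzero V (vproj V e)) e = e &
          forall e, vadd V (vopp e) e = vzero V (vproj V e)] /\
      [/\ forall t e e', vproj V e = vproj V e' ->
            vscale V t (vadd V e e') = vadd V (vscale V t e) (vscale V t e'),
          forall s t e,
            vscale V (s + t) e = vadd V (vscale V s e) (vscale V t e),
          forall s t e, vscale V (s * t) e = vscale V s (vscale V t e) &
          forall e, vscale V 1 e = e]].

(* An element of the dual bundle over n is a linear functional on the fibre
   over n, encoded by its extension by 0 to the other fibres. *)
Definition dual_pred (F : N * (E -> R)) : Prop :=
  [/\ forall e e', vproj V e = F.1 -> vproj V e' = F.1 ->
        F.2 (vadd V e e') = F.2 e + F.2 e',
      forall t e, vproj V e = F.1 -> F.2 (vscale V t e) = t * F.2 e &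
      forall e, vproj V e <> F.1 -> F.2 e = 0].

Definition dual : Type := {F : N * (E -> R) | `[< dual_pred F >]}.

Definition dbase (F : dual) : N := (val F).1.
Definition dual_pair (F : dual) (e : E) : R := (val F).2 e.

Lemma dual_zero_subproof (n : N) : `[< dual_pred (n, fun=> 0) >].
Proof.
by apply/asboolP; split=> //= *; rewrite ?addr0 ?mulr0.
Qed.

Definition dual_zero (n : N) : dual := Sub (n, fun=> 0) (dual_zero_subproof n).

(* [insubd] falls back on F only when F and F' lie over distinct points. *)
Definition dual_vb : vbstr R dual N :=
  VBStr dbase dual_zero
    (fun F F' => insubd F (dbase F, fun e => dual_pair F e + dual_pair F' e))
    (fun t F => insubd F (dbase F, fun e => t * dual_pair F e)).

End Algebra.

Definition prod_vb (E E' N N' : Type) (V : vbstr R E N) (V' : vbstr R E' N') :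
    vbstr R (E * E') (N * N') :=
  VBStr (fun e => (vproj V e.1, vproj V' e.2))
        (fun n => (vzero V n.1, vzero V' n.2))
        (fun e f => (vadd V e.1 f.1, vadd V' e.2 f.2))
        (fun t e => (vscale V t e.1, vscale V' t e.2)).

(* Local triviality: q^{-1}(U) is diffeomorphic to U x R^k by maps that are
   fibrewise linear. *)
Definition vector_bundle (E N : charted R) (V : vbstr R E N) : Prop :=
  [/\ vector_fibres V, smooth (vproj V) &
      forall n : N, exists (k : nat) (U : set N)
          (tau : E -> cprod N (euclid R k)) (sigma : cprod N (euclid R k) -> E),
        let QU := vproj V @^-1` U in
        [/\ open U /\ U n,
            smooth_on QU tau /\
            @smooth_on R (cprod N (euclid R k)) E [set p | U p.1] sigma,
            forall e, QU e -> (tau e).1 = vproj V e /\ sigma (tau e) = e,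
            forall p, U p.1 -> vproj V (sigma p) = p.1 /\ tau (sigma p) = p &
            (forall e e', QU e -> vproj V e = vproj V e' ->
               (tau (vadd V e e')).2 = (tau e).2 + (tau e').2) /\
            (forall t e, QU e -> (tau (vscale V t e)).2 = t *: (tau e).2)]].

(* (F, f) is a morphism of vector bundles, defined on the subbundle S of E
   over the submanifold vproj V @` S of N. *)
Definition vb_morphism_on (E N E' N' : charted R) (S : set E)
    (V : vbstr R E N) (V' : vbstr R E' N') (F : E -> E') (f : N -> N') : Prop :=
  [/\ smooth_on S F, smooth_on (vproj V @` S) f,
      forall e, S e -> vproj V' (F e) = f (vproj V e),
      forall e e', S e -> S e' -> vproj V e = vproj V e' ->
        F (vadd V e e') = vadd V' (F e) (F e') &
      forall t e, S e -> F (vscale V t e) = vscale V' t (F e)].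

Definition vb_morphism (E N E' N' : charted R) (V : vbstr R E N)
    (V' : vbstr R E' N') (F : E -> E') (f : N -> N') : Prop :=
  vb_morphism_on setT V V' F f.

Definition is_section (E N : charted R) (V : vbstr R E N) (s : N -> E) : Prop :=
  smooth s /\ forall n, vproj V (s n) = n.

End VectorBundles.

Section DoubleVectorBundleAxioms.
Variable R : realType.
Variables (M A B D : charted R).
Variables (vA : vbstr R A M) (vB : vbstr R B M).
Variables (vDA : vbstr R D A) (vDB : vbstr R D B).

(* The structure maps of D -> A are morphisms of vector bundles from the
   structures over B or M; the addition is a morphism from the bundle
   D x_A D -> B x_M B. *)
Definition structure_morphisms : Prop :=
  [/\ vb_morphism vDB vA (vproj vDA) (vproj vB),
      @vb_morphism_on R (cprod D D) (cprod B B) D B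
        [set p | vproj vDA p.1 = vproj vDA p.2] (prod_vb vDB vDB) vDB
        (fun p => vadd vDA p.1 p.2) (fun p => vadd vB p.1 p.2),
      forall t, vb_morphism vDB vDB (vscale vDA t) (vscale vB t) &
      vb_morphism vA vDB (vzero vDA) (vzero vB)].

(* D -> A x_M B is a surjective submersion, where the tangent space of
   A x_M B at (a, b) is T_a A x_{T_m M} T_b B. *)
Definition surjective_submersion : Prop :=
  (forall a b, vproj vA a = vproj vB b ->
     exists d, vproj vDA d = a /\ vproj vDB d = b) /\
  (forall d cD cA cB cM,
     let a := vproj vDA d in let b := vproj vDB d in let m := vproj vA a in
     atlas D cD -> atlas A cA -> atlas B cB -> atlas M cM ->
     cdom cD d -> cdom cA a -> cdom cB b -> cdom cM m ->
     forall (u : 'rV[R]_(cdim A)) (v : 'rV[R]_(cdim B)),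
       u *m tangent_mx cA cM (vproj vA) a = v *m tangent_mx cB cM (vproj vB) b ->
       exists w : 'rV[R]_(cdim D),
         w *m tangent_mx cD cA (vproj vDA) d = u /\
         w *m tangent_mx cD cB (vproj vDB) d = v).

End DoubleVectorBundleAxioms.

Record double_vector_bundle (R : realType) := DVB {
  dvbM : charted R;
  dvbA : charted R;
  dvbB : charted R;
  dvbD : charted R;
  vA : vbstr R dvbA dvbM;
  vB : vbstr R dvbB dvbM;
  vDA : vbstr R dvbD dvbA;
  vDB : vbstr R dvbD dvbB;
  dvb_manifolds :
    [/\ is_manifold dvbM, is_manifold dvbA, is_manifold dvbB & is_manifold dvbD];
  dvb_bundles :
    [/\ vector_bundle vA, vector_bundle vB, vector_bundle vDA & vector_bundle vDB];
  dvb_morphismsA : structure_morphisms vA vB vDA vDB;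
  dvb_morphismsB : structure_morphisms vB vA vDB vDA;
  dvb_submersion : surjective_submersion vA vB vDA vDB
}.
Arguments vA {R} d.
Arguments vB {R} d.
Arguments vDA {R} d.
Arguments vDB {R} d.

(* A linear section (s, X) of V : T -> S', where T has side bundles
   VS : S -> M and VS' : S' -> M and second structure W : T -> S. *)
Definition linear_section (R : realType) (T S S' M : charted R)
    (VS : vbstr R S M) (VS' : vbstr R S' M) (W : vbstr R T S) (V : vbstr R T S')
    (s : S' -> T) (X : M -> S) : Prop :=
  [/\ is_section VS X, is_section V s & vb_morphism VS' W s X].

(* The structure over C^* of the dual of V : T -> S, where T is a double vector
   bundle with second structure W : T -> S' and core included by [incl]. It is
   D^{*A} -> C^* for (T, S, S') = (D, A, B) and D^{*B} -> C^* for (D, B, A). *)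
Section DualOverCoreDual.
Variables (R : realType) (T S S' K M : Type).
Variables (V : vbstr R T S) (W : vbstr R T S').
Variables (VS : vbstr R S M) (VS' : vbstr R S' M).
Variables (VK : vbstr R K M) (incl : K -> T).

Definition dualC_proj (F : dual V) : dual VK :=
  let m := vproj VS (dbase F) in
  the (dual_zero VK m)
    [set k | dbase k = m /\
       forall c, vproj VK c = m ->
         dual_pair k c = dual_pair F (vadd W (vzero V (dbase F)) (incl c))].

Definition dualC_zero (k : dual VK) : dual V :=
  let m := dbase k in
  the (dual_zero V (vzero VS m))
    [set F | dbase F = vzero VS m /\
       forall b c, vproj VS' b = m -> vproj VK c = m ->
         dual_pair F (vadd V (vzero W b) (incl c)) = dual_pair k c].

Definition dualC_add (F F' : dual V) : dual V :=
  the F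
    [set G | [/\ dbase G = vadd VS (dbase F) (dbase F'),
       dualC_proj G = dualC_proj F &
       forall d d', vproj V d = dbase F -> vproj V d' = dbase F' ->
         vproj W d = vproj W d' ->
         dual_pair G (vadd W d d') = dual_pair F d + dual_pair F' d']].

(* For t = 0 the last condition alone does not determine G; the condition that
   G lies over the same element of the dual of the core as F does. *)
Definition dualC_scale (t : R) (F : dual V) : dual V :=
  the F
    [set G | [/\ dbase G = vscale VS t (dbase F),
       dualC_proj G = dualC_proj F &
       forall d, vproj V d = dbase F ->
         dual_pair G (vscale W t d) = t * dual_pair F d]].

Definition dualC_vb : vbstr R (dual V) (dual VK) :=
  VBStr dualC_proj dualC_zero dualC_add dualC_scale.

Definition squarecap (s : S -> T) (k : dual VK) : dual dualC_vb :=
  the (dual_zero dualC_vb k)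
    [set G | dbase G = k /\
       forall F, dualC_proj F = k -> dual_pair G F = dual_pair F (s (dbase F))].

End DualOverCoreDual.

Section DoubleVectorBundle.
Variables (R : realType) (D : double_vector_bundle R).

Definition core_pred (d : dvbD D) : Prop :=
  exists m, vproj (vDA D) d = vzero (vA D) m /\
            vproj (vDB D) d = vzero (vB D) m.

Definition core : Type := {d : dvbD D | `[< core_pred d >]}.

Lemma core_zero_subproof (m : dvbM D) :
  `[< core_pred (vzero (vDA D) (vzero (vA D) m)) >].
Proof.
case: (dvb_bundles D) => -[[zA _ _ _] _ _] _ [[zDA _ _ _] _ _] _.
case: (dvb_morphismsA D) => _ _ _ [_ _ zB _ _].
by apply/asboolP; exists m; rewrite zDA zB// zA.
Qed.

Definition core_zero (m : dvbM D) : core := Sub (vzero (vDA D) (vzero (vA D) m)) (core_zero_subproof m).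

(* The vector bundle C -> M; +_A and +_B coincide on C. [insubd] falls back on
   its default only when c and c' lie over distinct points. *)
Definition core_vb : vbstr R core (dvbM D) :=
  VBStr (fun c => vproj (vA D) (vproj (vDA D) (val c)))
        core_zero
        (fun c c' => insubd c (vadd (vDA D) (val c) (val c')))
        (fun t c => insubd c (vscale (vDA D) t (val c))).

Definition Cstar : Type := dual core_vb.

Definition DstarA : Type := dual (vDA D).
Definition DstarB : Type := dual (vDB D).

Definition vDstarA : vbstr R DstarA Cstar :=
  dualC_vb (vDA D) (vDB D) (vA D) (vB D) core_vb val.
Definition vDstarB : vbstr R DstarB Cstar :=
  dualC_vb (vDB D) (vDA D) (vB D) (vA D) core_vb val.

Definition DstarA_starC : Type := dual vDstarA.
Definition DstarB_starC : Type := dual vDstarB.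

(* R^D_A is characterized by <b, G>_{C^*} + <R^D_A b, d>_A = <G, d>_B. The first
   condition on F (R^D_A induces the identity on C-star) cannot be omitted: over
   another point of M the second one would hold vacuously. That R^D_A induces
   the identity on A is a consequence. *)
Definition RDA (b : DstarB_starC) : DstarA :=
  the (dual_zero (vDA D) (vzero (vA D) (dbase (dbase b))))
    [set F | vproj vDstarA F = dbase b /\
       forall (G : DstarB) (d : dvbD D),
       vproj vDstarB G = dbase b -> vproj (vDA D) d = dbase F ->
       vproj (vDB D) d = dbase G ->
       dual_pair b G + dual_pair F d = dual_pair G d].

Definition pairingC (b : DstarB_starC) (a : DstarA_starC) : R :=
  dual_pair a (RDA b).

Definition squarecapA : (dvbA D -> dvbD D) -> Cstar -> DstarA_starC :=
  @squarecap _ _ _ _ _ _ (vDA D) (vDB D) (vA D) (vB D) core_vb val.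
Definition squarecapB : (dvbB D -> dvbD D) -> Cstar -> DstarB_starC :=
  @squarecap _ _ _ _ _ _ (vDB D) (vDA D) (vB D) (vA D) core_vb val.

Definition linear_section_over_B (xi : dvbB D -> dvbD D) (X : dvbM D -> dvbA D) :=
  linear_section (vA D) (vB D) (vDA D) (vDB D) xi X.
Definition linear_section_over_A (eta : dvbA D -> dvbD D) (Y : dvbM D -> dvbB D) :=
  linear_section (vB D) (vA D) (vDB D) (vDA D) eta Y.

Definition warp (xi : dvbB D -> dvbD D) (X : dvbM D -> dvbA D)
    (eta : dvbA D -> dvbD D) (Y : dvbM D -> dvbB D) (m : dvbM D) : core :=
  the (core_zero m)
    [set c | [/\ vproj core_vb c = m,
       vsub (vDA D) (xi (Y m)) (eta (X m)) =
         vadd (vDB D) (val c) (vzero (vDA D) (X m)) &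
       vsub (vDB D) (xi (Y m)) (eta (X m)) =
         vadd (vDA D) (val c) (vzero (vDB D) (Y m))]].

Definition ell (c : dvbM D -> core) (k : Cstar) : R := dual_pair k (c (dbase k)).

End DoubleVectorBundle.

(* Main.v *)
(* Along a linear section both pairings reduce to the core. The element
   F = R^D_A(xi^cap(kappa)) of D^{*A} lies over X(m) and kappa and is
   d |-> <kappa, d -_A xi(b)> for d over (X(m), b), where d -_A xi(b) is viewed
   as an element of the core. It satisfies <F, d>_A = <Psi, d -_B xi(b)>_B for
   every Psi over b and kappa. Evaluating at d = eta(X(m)), as eta^cap does,
   gives -<kappa, w(xi, eta)(m)>.

   Smoothness enters twice: the two scalar multiplications agree on the core by
   continuity, and local triviality of A provides enough functionals on A_m to
   show that F lies over X(m). *)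

Require Import Defs.
From mathcomp Require Import all_boot all_order all_algebra.
From mathcomp Require Import all_classical all_reals all_analysis.
Import Order.TTheory GRing.Theory Num.Theory.
Import numFieldNormedType.Exports.
Set Implicit Arguments.
Unset Strict Implicit.
Unset Printing Implicit Defensive.
Local Open Scope classical_set_scope.
Local Open Scope ring_scope.

(** * Vector bundles: fibres and duals *)

Lemma theP {T : Type} (x0 : T) (P : set T) : (exists x, P x) -> P (the x0 P).
Proof. exact: (@xgetPex {classic T}). Qed.

Section VectorFibres.
Variables (R : realType) (E N : Type) (V : vbstr R E N).
Hypothesis hV : vector_fibres V.
Notation p := (vproj V).
Notation "x +' y" := (vadd V x y) (at level 50).
Implicit Types (n : N) (x y z : E).

Lemma vproj0 n : p (vzero V n) = n.
Proof. by case: hV. Qed.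

Lemma vprojD x y : p x = p y -> p (x +' y) = p x.
Proof. by case: hV => _ + _ _; apply. Qed.

Lemma vprojZ t x : p (vscale V t x) = p x.
Proof. by case: hV. Qed.

Lemma vprojB x y : p x = p y -> p (vsub V x y) = p x.
Proof. by move=> h; rewrite vprojD// vprojZ. Qed.

Lemma vaddA x y z : p x = p y -> p y = p z -> x +' (y +' z) = x +' y +' z.
Proof. by case: hV => _ _ _ [[+ _ _ _] _]; apply. Qed.

Lemma vaddC x y : p x = p y -> x +' y = y +' x.
Proof. by case: hV => _ _ _ [[_ + _ _] _]; apply. Qed.

Lemma vadd0l n x : p x = n -> vzero V n +' x = x.
Proof. by move=> <-; case: hV => _ _ _ [[]]. Qed.

Lemma vadd0r n x : p x = n -> x +' vzero V n = x.
Proof. by move=> h; rewrite vaddC ?vproj0// vadd0l. Qed.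

Lemma vaddNl x : vopp V x +' x = vzero V (p x).
Proof. by case: hV => _ _ _ [[]]. Qed.

Lemma vscaleDr t x y : p x = p y ->
  vscale V t (x +' y) = vscale V t x +' vscale V t y.
Proof. by case: hV => _ _ _ [_ [+ _ _ _]]; apply. Qed.

Lemma vscaleDl s t x : vscale V (s + t) x = vscale V s x +' vscale V t x.
Proof. by case: hV => _ _ _ [_ []]. Qed.

Lemma vscaleA s t x : vscale V s (vscale V t x) = vscale V (s * t) x.
Proof. by case: hV => _ _ _ [_ []]. Qed.

Lemma vscale1 x : vscale V 1 x = x.
Proof. by case: hV => _ _ _ [_ []]. Qed.

Lemma vaddACA x y z w : p x = p y -> p y = p z -> p z = p w ->
  (x +' y) +' (z +' w) = (x +' z) +' (y +' w).
Proof.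
move=> xy yz zw; rewrite -!vaddA ?vprojD//; try congruence.
by rewrite (vaddA yz zw) (vaddC yz) -vaddA//; congruence.
Qed.

Lemma vaddIl x y z : p x = p y -> p x = p z -> x +' y = x +' z -> y = z.
Proof.
move=> xy xz /(congr1 (vadd V (vopp V x))).
by rewrite !vaddA ?vprojZ// vaddNl !vadd0l.
Qed.

Lemma vaddIr x y z : p y = p x -> p z = p x -> y +' x = z +' x -> y = z.
Proof. by move=> yx zx; rewrite vaddC// (vaddC zx); apply: vaddIl. Qed.

Lemma vsubK x y : p x = p y -> vsub V x y +' y = x.
Proof. by move=> h; rewrite -vaddA ?vprojZ// vaddNl vadd0r. Qed.

Lemma vsubxx x : vsub V x x = vzero V (p x).
Proof. by rewrite /vsub vaddC ?vprojZ// vaddNl. Qed.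

Lemma vscale0l x : vscale V 0 x = vzero V (p x).
Proof.
apply: (@vaddIl (vscale V 0 x)); rewrite ?vproj0 ?vprojZ//.
by rewrite -vscaleDl addr0 vadd0r// vprojZ.
Qed.

Lemma vscale0r t n : vscale V t (vzero V n) = vzero V n.
Proof.
have E0 : vscale V 0 (vzero V n) = vzero V n by rewrite vscale0l vproj0.
by rewrite -{1}E0 vscaleA mulr0 E0.
Qed.

End VectorFibres.

Section Duals.
Variables (R : realType) (E N : Type) (V : vbstr R E N).
Implicit Types F : dual V.

Lemma dual_pairD F x y : vproj V x = dbase F -> vproj V y = dbase F ->
  dual_pair F (vadd V x y) = dual_pair F x + dual_pair F y.
Proof. by case: F => F /= hF; case/asboolP: (hF) => + _ _; apply. Qed.

Lemma dual_pairZ F t x : vproj V x = dbase F ->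
  dual_pair F (vscale V t x) = t * dual_pair F x.
Proof. by case: F => F /= hF; case/asboolP: (hF) => _ + _; apply. Qed.

Lemma dual_pairN F x : vproj V x = dbase F ->
  dual_pair F (vopp V x) = - dual_pair F x.
Proof. by move=> h; rewrite dual_pairZ// mulN1r. Qed.

(** Off the common fibre both functionals are extended by 0, so only the values on the fibre have to
    be compared. *)
Lemma dual_ext F F' : dbase F = dbase F' ->
  (forall x, vproj V x = dbase F -> dual_pair F x = dual_pair F' x) -> F = F'.
Proof.
case: F F' => [[n f] hF] [[n' f'] hF'] /=; rewrite /dbase /dual_pair /= => nn'.
subst n' => ff'; apply: val_inj => /=; congr pair; apply/funext => x.
case: (pselect (vproj V x = n)) => [/ff'//|hx].
have /asboolP[_ _ /= f0] := hF; have /asboolP[_ _ /= f'0] := hF'.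
by rewrite f0// f'0.
Qed.

(* The functional is given by its graph, which may involve choices. *)
Lemma dual_of_graph (n : N) (P : E -> R -> Prop) :
  (forall x y, vproj V x = n -> vproj V y = n -> vproj V (vadd V x y) = n) ->
  (forall t x, vproj V x = n -> vproj V (vscale V t x) = n) ->
  (forall x, vproj V x = n -> exists r, P x r) ->
  (forall x r r', vproj V x = n -> P x r -> P x r' -> r = r') ->
  (forall x y r s, vproj V x = n -> vproj V y = n ->
     P x r -> P y s -> P (vadd V x y) (r + s)) ->
  (forall t x r, vproj V x = n -> P x r -> P (vscale V t x) (t * r)) ->
  exists2 F : dual V, dbase F = n &
    forall x r, vproj V x = n -> P x r -> dual_pair F x = r.
Proof.
move=> nD nZ Pex Puniq PD PZ.
(* Off the fibre the chosen value is forced to be 0, as the encoding of [dual] demands. *)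
have /choice[f fP] x : exists r, (vproj V x = n -> P x r) /\ (vproj V x <> n -> r = 0).
  have [hx|hx] := pselect (vproj V x = n); last by exists 0.
  by have [r Pr] := Pex _ hx; exists r.
have fE x r : vproj V x = n -> P x r -> f x = r.
  by move=> hx Pr; apply: (Puniq x) => //; apply: (fP x).1.
have hF : `[< @dual_pred R E N V (n, f) >].
  apply/asboolP; split=> /=.
  - move=> x y hx hy; apply: fE; first exact: nD.
    by apply: PD => //; apply: (fP _).1.
  - move=> t x hx; apply: fE; first exact: nZ.
    by apply: PZ => //; apply: (fP _).1.
  - by move=> x; apply: (fP x).2.
by exists (Sub (n, f) hF).
Qed.

Hypothesis hV : vector_fibres V.

Lemma dual_pair0 F n : n = dbase F -> dual_pair F (vzero V n) = 0.
Proof.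
by move=> h; rewrite -(vscale0r hV 0) dual_pairZ ?mul0r// (vproj0 hV).
Qed.

Lemma dual_of_linear (n : N) (f : E -> R) :
  (forall x y, vproj V x = n -> vproj V y = n -> f (vadd V x y) = f x + f y) ->
  (forall t x, vproj V x = n -> f (vscale V t x) = t * f x) ->
  exists2 F : dual V, dbase F = n &
    forall x, vproj V x = n -> dual_pair F x = f x.
Proof.
move=> fD fZ; have [|||||| F Fn FE] := @dual_of_graph n (fun x r => r = f x).
- by move=> x y hx hy; rewrite (vprojD hV)//; congruence.
- by move=> t x hx; rewrite (vprojZ hV).
- by move=> x _; exists (f x).
- by move=> x r r' _ -> ->.
- by move=> x y r s hx hy -> ->; rewrite fD.
- by move=> t x r hx ->; rewrite fZ.
- by exists F => // x hx; rewrite (FE _ (f x)).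
Qed.

End Duals.

(** * Consequences of continuity and local triviality *)

Section Smooth.
Variable R : realType.

(** Near each point of [Z] the map [f \o h] agrees with [g \o h] for a local smooth extension [g] of
    [f]; the set [S] itself may fail to be open. *)
Lemma smooth_on_continuous_comp (Z : topologicalType) (X Y : charted R)
    (S : set X) (f : X -> Y) (h : Z -> X) :
  smooth_on S f -> (forall z, S (h z)) -> continuous h -> continuous (f \o h).
Proof.
move=> hf Sh hc z; have [U [g [oU Uz [gc _] fg]]] := hf _ (Sh z).
have nU : \forall y \near z, U (h y).
  by apply: (hc z); apply: open_nbhs_nbhs.
have E : {near z, g \o h =1 f \o h}.
  near=> y => /=; rewrite fg//; apply/mem_set; split; first exact: Sh.
  by near: y.
rewrite /continuous_at.
apply: cvg_trans (near_eq_cvg E) _.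
rewrite /= (fg (h z)); last by apply/mem_set; split.
apply: (continuous_comp (hc z)); apply: gc; exact/mem_set.
Unshelve. all: by end_near. Qed.

(** In a local trivialization the curve is the image under [sigma] of a straight line in a single
    fibre. *)
Lemma vscale_continuous (E N : charted R) (V : vbstr R E N) (e : E) :
  vector_bundle V -> continuous (fun t : R => vscale V t e).
Proof.
move=> [hV _ loc]; have [k [U [tau [sigma /= [[_ Un] [_ sS] ts st [_ tZ]]]]]] := loc (vproj V e).
pose h (t : R) : cprod N (euclid R k) := (vproj V e, t *: (tau e).2).
have -> : (fun t => vscale V t e) = sigma \o h.
  apply/funext => t /=.
  have Ut : U (vproj V (vscale V t e)) by rewrite (vprojZ hV).
  have [t1 <-] := ts _ Ut; congr sigma.
  by rewrite [LHS]surjective_pairing t1 tZ// (vprojZ hV).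
apply: (smooth_on_continuous_comp sS) => //= t.
have := @cvg_pair _ _ _ (nbhs t) (nbhs (vproj V e)) (nbhs (t *: (tau e).2))
  _ _ _ (fun=> vproj V e) (fun t => t *: (tau e).2).
by apply; [exact: cvg_cst|exact: scalel_continuous].
Qed.

(* Both scalings are additive in the scalar and commute with the common
   addition, so they agree on rational scalars, hence by continuity on all. *)
Lemma vscale_coincide (E N N' : charted R) (V : vbstr R E N) (W : vbstr R E N')
  (e : E) (S : set E) (n' : N') : hausdorff_space E ->
  vector_bundle V -> vector_bundle W -> S e ->
  (forall t x, S x -> S (vscale V t x)) ->
  (forall x, S x -> vproj W x = n') ->
  (forall x y, S x -> S y -> vadd V x y = vadd W x y) ->
  (forall x, S x -> vscale V 0 x = vscale W 0 x) ->
  forall t, vscale V t e = vscale W t e.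
Proof.
move=> hE bV bW Se SV SW addE zE t.
have [[hV _ _] [hW _ _]] := (bV, bW).
have natE n x : S x -> vscale V n%:R x = vscale W n%:R x.
  move=> Sx; elim: n => [|n IH]; first exact: zE.
  rewrite -natr1 (vscaleDl hV) (vscaleDl hW) -IH (vscale1 hV) (vscale1 hW).
  by rewrite addE//; apply: SV.
have intE (z : int) x : S x -> vscale V z%:~R x = vscale W z%:~R x.
  move=> Sx; case: z => n; first by rewrite natE.
  rewrite NegzE mulrNz; set s : R := n.+1%:~R.
  (* Adding [s] times [x], which by [natE] is the same element in both structures, turns both sides
     into scalings by 0. *)
  apply: (vaddIr hW (x := vscale W s x)).
  - by rewrite (vprojZ hW) SW ?SW//; apply: SV.
  - by rewrite !(vprojZ hW).
  rewrite -{1}[vscale W s x]natE// -addE; [|exact: SV..].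
  by rewrite -(vscaleDl hV) -(vscaleDl hW) addNr zE.
(* With [y] the [V]-quotient of [x] by [n.+1], [natE] gives that [n.+1] times [y] is [x] for [W]
   too, so [y] is also the [W]-quotient. *)
have invE n x : S x -> vscale V n.+1%:R^-1 x = vscale W n.+1%:R^-1 x.
  move=> Sx; set y := LHS; have Sy : S y by exact: SV.
  have -> : x = vscale W n.+1%:R y.
    by rewrite -natE// (vscaleA hV) mulfV ?pnatr_eq0// (vscale1 hV).
  by rewrite (vscaleA hW) mulVf ?pnatr_eq0// (vscale1 hW).
have ratE (q : rat) : vscale V (ratr q) e = vscale W (ratr q) e.
  rewrite /ratr -(vscaleA hV) -(vscaleA hW); case: (denq q) (denq_gt0 q) => [[|n]|]// _.
  rewrite -[n.+1%:~R]/(n.+1%:R) -invE// intE//; exact: SV.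
apply: contrapT => /eqP VW.
move: hE; rewrite open_hausdorff => /(_ _ _ VW).
move=> [[P Q] /= [/set_mem Pt /set_mem Qt] [oP oQ /eqP PQ]].
(* If the scalings by [t] differed, disjoint open sets would separate them for all scalars near [t],
   and some of these are rational. *)
pose O := (fun t => vscale V t e) @^-1` P `&` (fun t => vscale W t e) @^-1` Q.
have oO : open O.
  by apply: openI; apply: open_comp => // s _; apply: vscale_continuous.
have [s [[Ps Qs] [q _ qs]]] := dense_rat (ex_intro _ t (conj Pt Qt)) oO.
by move/disjoints_subset: PQ => /(_ _ Ps); apply; rewrite /= -qs ratE qs.
Qed.

(** The coordinates of a local trivialization are linear functionals on the fibre, and together they
    determine a point of it. *)
Lemma dual_separates (E N : charted R) (V : vbstr R E N) (x y : E) :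
  vector_bundle V -> vproj V x = vproj V y ->
  (forall F : dual V, dbase F = vproj V x -> dual_pair F x = dual_pair F y) ->
  x = y.
Proof.
move=> [hV _ loc] xy FE.
have [k [U [tau [sigma /= [[_ Un] _ ts _ [tD tZ]]]]]] := loc (vproj V x).
have [tx <-] := ts x Un; have Uy : U (vproj V y) by rewrite -xy.
have [ty <-] := ts y Uy; congr sigma.
rewrite [LHS]surjective_pairing [RHS]surjective_pairing tx ty xy; congr pair.
apply/rowP => i.
have [|| F Fx Fi] := dual_of_linear hV (n := vproj V x) (f := fun z => (tau z).2 0 i).
- by move=> z w hz hw /=; rewrite tD ?mxE//= ?hz ?hw.
- by move=> t z hz /=; rewrite tZ ?mxE//= hz.
by rewrite -!Fi// FE.
Qed.

End Smooth.

(** * Fibrewise algebra of a double vector bundle *)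

(** The equations in [structure_morphisms], freed from smoothness. The field [proj_zero] comes from
    the axioms for the zero section of [W], hence from those of the other structure. *)
Record structure_linear (R : realType) (T S S' M : Type) (V : vbstr R T S)
    (W : vbstr R T S') (VS : vbstr R S M) (VS' : vbstr R S' M) : Prop := {
  proj_proj : forall d, vproj VS (vproj V d) = vproj VS' (vproj W d);
  proj_add : forall d d', vproj W d = vproj W d' ->
    vproj V (vadd W d d') = vadd VS (vproj V d) (vproj V d');
  proj_scale : forall t d, vproj V (vscale W t d) = vscale VS t (vproj V d);
  proj_zero : forall b, vproj V (vzero W b) = vzero VS (vproj VS' b);
  add_interchange : forall d1 d2 e1 e2, vproj V d1 = vproj V d2 ->
    vproj V e1 = vproj V e2 -> vproj W d1 = vproj W e1 ->
    vproj W d2 = vproj W e2 ->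
    vadd V (vadd W d1 e1) (vadd W d2 e2) = vadd W (vadd V d1 d2) (vadd V e1 e2);
  scale_add : forall t d d', vproj W d = vproj W d' ->
    vscale V t (vadd W d d') = vadd W (vscale V t d) (vscale V t d');
  scale_scale : forall s t d, vscale V s (vscale W t d) = vscale W t (vscale V s d);
  zero_add : forall a a', vproj VS a = vproj VS a' ->
    vzero V (vadd VS a a') = vadd W (vzero V a) (vzero V a');
  zero_scale : forall t a, vzero V (vscale VS t a) = vscale W t (vzero V a)
}.

(** The core is an abstract [K] with an inclusion, so the same [K] serves after the two sides are
    exchanged. That both structures of [T] agree on the core is contained in the fields for [V] and
    [W]. *)
Record core_inclusion (R : realType) (T S S' K M : Type) (V : vbstr R T S)
    (W : vbstr R T S') (VS : vbstr R S M) (VS' : vbstr R S' M)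
    (VK : vbstr R K M) (incl : K -> T) : Prop := {
  incl_inj : injective incl;
  incl_projV : forall c, vproj V (incl c) = vzero VS (vproj VK c);
  incl_projW : forall c, vproj W (incl c) = vzero VS' (vproj VK c);
  incl_surj : forall m d, vproj V d = vzero VS m -> vproj W d = vzero VS' m ->
    exists2 c, vproj VK c = m & incl c = d;
  incl_addV : forall c c', vproj VK c = vproj VK c' ->
    incl (vadd VK c c') = vadd V (incl c) (incl c');
  incl_addW : forall c c', vproj VK c = vproj VK c' ->
    incl (vadd VK c c') = vadd W (incl c) (incl c');
  incl_scaleV : forall t c, incl (vscale VK t c) = vscale V t (incl c);
  incl_scaleW : forall t c, incl (vscale VK t c) = vscale W t (incl c)
}.

(* Symmetric under exchange of the two sides, so that each lemma below serves
   both D^{*A} and D^{*B}. *)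
Record double_vector_fibres (R : realType) (T S S' K M : Type)
    (V : vbstr R T S) (W : vbstr R T S') (VS : vbstr R S M)
    (VS' : vbstr R S' M) (VK : vbstr R K M) (incl : K -> T) : Prop := {
  fibresV : vector_fibres V;
  fibresW : vector_fibres W;
  fibresVS : vector_fibres VS;
  fibresVS' : vector_fibres VS';
  linearV : structure_linear V W VS VS';
  linearW : structure_linear W V VS' VS;
  over_surj : forall a b, vproj VS a = vproj VS' b ->
    exists2 d, vproj V d = a & vproj W d = b;
  coreP : core_inclusion V W VS VS' VK incl
}.

Lemma double_vector_fibres_sym (R : realType) (T S S' K M : Type)
    (V : vbstr R T S) (W : vbstr R T S') (VS : vbstr R S M)
    (VS' : vbstr R S' M) (VK : vbstr R K M) (incl : K -> T) :
  double_vector_fibres V W VS VS' VK incl ->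
  double_vector_fibres W V VS' VS VK incl.
Proof.
case=> hV hW hVS hVS' lV lW surj [i1 i2 i3 i4 i5 i6 i7 i8]; split=> //.
  by move=> b a /esym/surj[d da db]; exists d.
by split=> // m d dW dV; apply: i4.
Qed.

Record linear_lift (R : realType) (T S S' M : Type) (V : vbstr R T S)
    (W : vbstr R T S') (VS : vbstr R S M) (s : S -> T) (Z : M -> S') : Prop := {
  lift_proj : forall a, vproj V (s a) = a;
  lift_over : forall a, vproj W (s a) = Z (vproj VS a);
  lift_add : forall a a', vproj VS a = vproj VS a' ->
    s (vadd VS a a') = vadd W (s a) (s a');
  lift_scale : forall t a, s (vscale VS t a) = vscale W t (s a)
}.

(** * Differences in the core and the projection to the dual of the core *)

Section DoubleVectorFibres.
Variables (R : realType) (T S S' K M : Type).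
Variables (V : vbstr R T S) (W : vbstr R T S').
Variables (VS : vbstr R S M) (VS' : vbstr R S' M).
Variables (VK : vbstr R K M) (incl : K -> T).
Hypothesis H : double_vector_fibres V W VS VS' VK incl.
Notation pV := (vproj V).
Notation pW := (vproj W).
Notation "x +V y" := (vadd V x y) (at level 50).
Notation "x +W y" := (vadd W x y) (at level 50).

Let hV := fibresV H.
Let hW := fibresW H.
Let hVS := fibresVS H.
Let hVS' := fibresVS' H.
Let lV := linearV H.
Let lW := linearW H.
Let hK := coreP H.

(** A zero of [VS] is 0 times itself, and [vzero V] turns this into a [W]-scaling by 0. *)
Lemma zeroVW m : vzero V (vzero VS m) = vzero W (vzero VS' m).
Proof.
have zz : vscale VS 0 (vzero VS m) = vzero VS m by exact: vscale0r.
by rewrite -[in LHS]zz (zero_scale lV) (vscale0l hW) (proj_zero lW) (vproj0 hVS).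
Qed.

Lemma core_vproj c : vproj VK c = vproj VS (pV (incl c)).
Proof. by rewrite (incl_projV hK) (vproj0 hVS). Qed.

Lemma core_vprojD c c' : vproj VK c = vproj VK c' ->
  vproj VK (vadd VK c c') = vproj VK c.
Proof.
move=> cc'; rewrite !core_vproj (incl_addV hK)// (vprojD hV)//.
by rewrite !(incl_projV hK) cc'.
Qed.

Lemma core_vprojZ t c : vproj VK (vscale VK t c) = vproj VK c.
Proof. by rewrite !core_vproj (incl_scaleV hK) (vprojZ hV). Qed.

Lemma core_zero_ex m : exists2 c, vproj VK c = m & incl c = vzero V (vzero VS m).
Proof. by apply: (incl_surj hK); rewrite ?(vproj0 hV)// zeroVW (vproj0 hW). Qed.

(** The zero of the core is recognised through [incl]: it is fixed by scaling by 0, so homogeneity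
    makes the pairing vanish. *)
Lemma dual_core0 (k : dual VK) c : vproj VK c = dbase k ->
  incl c = vzero V (vzero VS (dbase k)) -> dual_pair k c = 0.
Proof.
move=> ck ic; have {1}<- : vscale VK 0 c = c.
  by apply: (incl_inj hK); rewrite (incl_scaleV hK) ic (vscale0r hV).
by rewrite dual_pairZ ?mul0r.
Qed.

(* Write 0^V as d' -_V d' and exchange the two subtractions. *)
Lemma core_difference d d' : pV d = pV d' -> pW d = pW d' ->
  exists c, [/\ vproj VK c = vproj VS (pV d),
    vsub V d d' = incl c +W vzero V (pV d) &
    vsub W d d' = incl c +V vzero W (pW d)].
Proof.
move=> dV dW; pose m := vproj VS (pV d).
have Wx x y : pV x = pV y -> pW x = pW y -> pW (vsub V x y) = vzero VS' (vproj VS' (pW x)).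
  move=> xyV xyW; rewrite (proj_add lW) ?(vprojZ hV)// (proj_scale lW) -xyW.
  exact: (vsubxx hVS').
have Vx x y : pW x = pW y -> pV x = pV y -> pV (vsub W x y) = vzero VS (vproj VS (pV x)).
  move=> xyW xyV; rewrite (proj_add lV) ?(vprojZ hW)// (proj_scale lV) -xyV.
  exact: (vsubxx hVS).
have mE : vproj VS' (pW d) = m by rewrite -(proj_proj lV).
have zV : pW (vzero V (pV d)) = vzero VS' m by rewrite (proj_zero lW).
have zW : pV (vzero W (pW d)) = vzero VS m by rewrite (proj_zero lV) mE.
set x := vsub V d d'; have xW : pW x = vzero VS' m by rewrite Wx// mE.
have xV : pV x = pV d by rewrite (vprojB hV).
set y := vsub W d d'; have yV : pV y = vzero VS m by rewrite Vx.
have yW : pW y = pW d by rewrite (vprojB hW).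
have E : vsub W x (vzero V (pV d)) = vsub V y (vzero W (pW d)).
{ rewrite {1}dV dW -(vsubxx hV) -(vsubxx hW) /vsub /vopp.
  have sV z w : pV z = pV w -> vscale W (-1) (z +V w) = vscale W (-1) z +V vscale W (-1) w.
    exact: (scale_add lW).
  rewrite sV ?(vprojZ hV)// -(scale_scale lV) -(add_interchange lV).
  1: by rewrite -(scale_add lV) ?(vprojZ hW).
  all: by rewrite ?(vprojZ hV) ?(vprojZ hW) ?(proj_scale lW) ?(vprojZ hW) ?dW. }
(* By [E] the double difference can be formed in either order. It projects to zeros on both sides,
   so it is a core element, and this one element serves both equations. *)
have [||c cm cE] := incl_surj hK (m := m) (d := vsub W x (vzero V (pV d))).
- by rewrite Vx ?xW ?zV ?(vproj0 hV) ?xV.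
- by rewrite (vprojB hW) ?xW ?zV.
exists c; split=> //; first by rewrite cE (vsubK hW) ?xW ?zV.
by rewrite cE E (vsubK hV) ?yV ?zW.
Qed.

Lemma core_decomp d d' : pV d = pV d' -> pW d = pW d' ->
  exists c, [/\ vproj VK c = vproj VS (pV d),
    d = d' +V (incl c +W vzero V (pV d)) &
    d = d' +W (incl c +V vzero W (pW d))].
Proof.
move=> dV dW; have [c [cm cV cW]] := core_difference dV dW.
exists c; split=> //.
  by rewrite -cV (vaddC hV) ?(vsubK hV)// (vprojB hV).
by rewrite -cW (vaddC hW) ?(vsubK hW)// (vprojB hW).
Qed.

(** This lemma and the next three make the map sending [c] to [incl c +W vzero V a] a linear
    injection of a core fibre into the [V]-fibre over [a], with image over the zero of [S']. *)
Lemma core_addP c a : vproj VK c = vproj VS a ->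
  pV (incl c +W vzero V a) = a /\ pW (incl c +W vzero V a) = vzero VS' (vproj VS a).
Proof.
move=> ca; have h : pW (incl c) = pW (vzero V a) by rewrite (proj_zero lW) (incl_projW hK) ca.
rewrite (proj_add lV)// (vprojD hW)// (incl_projV hK) (incl_projW hK) (vproj0 hV).
by rewrite ca (vadd0l hVS).
Qed.

Lemma core_addD c c' a : vproj VK c = vproj VS a -> vproj VK c' = vproj VS a ->
  (incl c +W vzero V a) +V (incl c' +W vzero V a) =
  incl (vadd VK c c') +W vzero V a.
Proof.
move=> ca ca'; rewrite (add_interchange lV).
- by rewrite (incl_addV hK) ?ca ?ca'// (vadd0l hV) ?(vproj0 hV).
- by rewrite !(incl_projV hK) ca ca'.
- by [].
- by rewrite (proj_zero lW) (incl_projW hK) ca.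
- by rewrite (proj_zero lW) (incl_projW hK) ca'.
Qed.

Lemma core_addZ t c a : vproj VK c = vproj VS a ->
  vscale V t (incl c +W vzero V a) = incl (vscale VK t c) +W vzero V a.
Proof.
move=> ca; rewrite (scale_add lV); last by rewrite (proj_zero lW) (incl_projW hK) ca.
by rewrite (vscale0r hV) (incl_scaleV hK).
Qed.

Lemma core_addI c c' a : vproj VK c = vproj VS a -> vproj VK c' = vproj VS a ->
  incl c +W vzero V a = incl c' +W vzero V a -> c = c'.
Proof.
move=> ca ca' h; apply: (incl_inj hK); apply: (vaddIr hW (x := vzero V a)) h.
- by rewrite (proj_zero lW) (incl_projW hK) ca.
- by rewrite (proj_zero lW) (incl_projW hK) ca'.
Qed.

Local Notation projC := (@dualC_proj R T S S' K M V W VS VK incl).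

(** Restricting [F] along the linear map of the core into its fibre gives a functional on the core,
    so [the] does not return its default value. *)
Lemma dualC_projP (F : dual V) : dbase (projC F) = vproj VS (dbase F) /\
  forall c, vproj VK c = vproj VS (dbase F) ->
    dual_pair (projC F) c = dual_pair F (incl c +W vzero V (dbase F)).
Proof.
pose m := vproj VS (dbase F).
have cz c : vproj VK c = m ->
    vzero V (dbase F) +W incl c = incl c +W vzero V (dbase F).
  by move=> cm; rewrite (vaddC hW)// (proj_zero lW) (incl_projW hK) cm.
have [|k1 k2] := @theP _ (dual_zero VK m)
  [set k | dbase k = m /\ forall c, vproj VK c = m ->
     dual_pair k c = dual_pair F (vzero V (dbase F) +W incl c)]; last first.
  by split=> // c cm; rewrite k2// cz.
have [|||||| k k1 k2] := @dual_of_graph R K M VK m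
  (fun c r => r = dual_pair F (incl c +W vzero V (dbase F))).
- by move=> c c' cm cm'; rewrite core_vprojD ?cm.
- by move=> t c cm; rewrite core_vprojZ.
- by move=> c _; eexists.
- by move=> c r r' _ -> ->.
- move=> c c' r r' cm cm' -> ->; rewrite -core_addD// dual_pairD//.
  + by rewrite (core_addP cm).1.
  + by rewrite (core_addP cm').1.
- by move=> t c r cm ->; rewrite -core_addZ// dual_pairZ// (core_addP cm).1.
by exists k; split=> // c cm; rewrite cz//; apply: k2.
Qed.

Lemma dualC_projE (F : dual V) (k : dual VK) : dbase k = vproj VS (dbase F) ->
  (forall c, vproj VK c = vproj VS (dbase F) ->
    dual_pair F (incl c +W vzero V (dbase F)) = dual_pair k c) ->
  projC F = k.
Proof.
move=> kF kE; have [p1 p2] := dualC_projP F; apply: dual_ext; first by rewrite p1.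
by move=> c; rewrite p1 => cm; rewrite p2// kE.
Qed.

(** Used with [core_decomp]: elements of [T] with equal projections have pairings that differ by a
    value of the projection of [F] to the dual of the core. *)
Lemma dual_pair_core (F : dual V) d c : pV d = dbase F ->
  vproj VK c = vproj VS (dbase F) ->
  dual_pair F (d +V (incl c +W vzero V (dbase F))) =
  dual_pair F d + dual_pair (projC F) c.
Proof.
move=> dF cF; rewrite dual_pairD//; last by rewrite (core_addP cF).1.
by rewrite (dualC_projP F).2.
Qed.


(* The functional is d |-> k (d -_V s d), s being evaluated at the projection of
   d and the difference taken in the core. *)
Lemma dual_of_lift (s : S' -> T) (X : M -> S) (k : dual VK) :
  linear_lift W V VS' s X -> exists F : dual V,
    [/\ dbase F = X (dbase k), projC F = k &
        forall b, vproj VS' b = dbase k -> dual_pair F (s b) = 0].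
Proof.
move=> [sW sV sD sZ]; set m := dbase k; pose a := X m.
have am : vproj VS a = m.
  by rewrite /a -{1}[m](vproj0 hVS') -sV (proj_proj lV) sW (vproj0 hVS').
have dm d : pV d = a -> vproj VS' (pW d) = m by rewrite -(proj_proj lV) => ->.
have sa b : vproj VS' b = m -> pV (s b) = a by move=> bm; rewrite sV bm.
pose P d r := exists c, [/\ vproj VK c = m,
  d = s (pW d) +V (incl c +W vzero V a) & r = dual_pair k c].
have ca c : vproj VK c = m -> pV (incl c +W vzero V a) = a.
  by move=> cm; rewrite (core_addP _).1// am.
(* The core element [c] is determined by [d], through cancellation of [s (pW d)] and then
   [core_addI]. *)
have Puniq d r r' : pV d = a -> P d r -> P d r' -> r = r'.
  move=> da [c [cm dc ->]] [c' [c'm dc' ->]]; congr dual_pair.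
  apply: (core_addI (a := a)); rewrite ?am//.
  by apply: (vaddIl hV (x := s (pW d))); rewrite -?dc ?ca ?sa ?dm.
have s0 : s (vzero VS' m) = vzero V a.
  rewrite -{1}(vscale0r hVS' 0) sZ (vscale0l hV) sa//.
  by rewrite (vproj0 hVS').
have [||||||F Fa FP] := @dual_of_graph R T S V a P.
- by move=> x y xa ya; rewrite (vprojD hV) ?xa.
- by move=> t x xa; rewrite (vprojZ hV).
- move=> d da; have [||c [cm dc _]] := @core_decomp d (s (pW d)).
  + by rewrite sa ?dm.
  + by rewrite sW.
  rewrite da am in cm; rewrite da in dc.
  by exists (dual_pair k c), c.
- exact: Puniq.
- move=> x y r r' xa ya [c [cm xc ->]] [c' [c'm yc ->]].
  exists (vadd VK c c'); split; first by rewrite core_vprojD ?cm.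
    rewrite {1}xc {1}yc (vaddACA hV) ?ca ?sa ?dm//.
    rewrite core_addD ?am// (proj_add lW) ?xa// sD// !dm//.
  by rewrite dual_pairD.
- move=> t x r xa [c [cm xc ->]].
  exists (vscale VK t c); split; first by rewrite core_vprojZ.
    rewrite {1}xc (vscaleDr hV) ?ca ?sa ?dm//.
    by rewrite core_addZ ?am// (proj_scale lW) sZ.
  by rewrite dual_pairZ.
exists F; split=> //.
  (* Over the zero of [S'] the lift is the zero of [V] by [s0], so the core difference is [c]
     itself. *)
  apply: dualC_projE; rewrite Fa ?am// => c cm; apply: FP; first by rewrite ca.
  exists c; split=> //; rewrite (core_addP _).2 ?am// s0 (vadd0l hV)//.
  by rewrite ca.
move=> b bm; apply: FP; first by rewrite sa.
(* On the lift itself the core difference is zero. *)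
have [c cm ic] := core_zero_ex m.
exists c; split=> //; last by rewrite dual_core0.
by rewrite sW ic zeroVW (vadd0l hW) ?(vadd0r hV) ?sa// (proj_zero lW) am.
Qed.

(** Fed into [dual_of_lift] with the sides exchanged, it yields the zero over [k] in the dual of
    [W], regarded as a bundle over the dual of the core. *)
Lemma linear_lift_zero : linear_lift V W VS (vzero V) (vzero VS').
Proof.
by split; [exact: (vproj0 hV)|exact: (proj_zero lW)|exact: (zero_add lV)|
  exact: (zero_scale lV)].
Qed.

End DoubleVectorFibres.

(** * Addition, scaling and squarecap sections over the dual of the core *)

Section DualOperations.
Variables (R : realType) (T S S' K M : Type).
Variables (V : vbstr R T S) (W : vbstr R T S').
Variables (VS : vbstr R S M) (VS' : vbstr R S' M).
Variables (VK : vbstr R K M) (incl : K -> T).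
Hypothesis H : double_vector_fibres V W VS VS' VK incl.
Notation pV := (vproj V).
Notation pW := (vproj W).
Notation "x +V y" := (vadd V x y) (at level 50).
Notation "x +W y" := (vadd W x y) (at level 50).

Let hV := fibresV H.
Let hW := fibresW H.
Let hVS := fibresVS H.
Let hVS' := fibresVS' H.
Let lV := linearV H.
Let lW := linearW H.
Let hK := coreP H.

Local Notation projC := (@dualC_proj R T S S' K M V W VS VK incl).
Local Notation addC := (@dualC_add R T S S' K M V W VS VK incl).
Local Notation scaleC := (@dualC_scale R T S S' K M V W VS VK incl).
Local Notation dualC := (@dualC_vb R T S S' K M V W VS VS' VK incl).

Lemma dbase_projC (F : dual V) : vproj VS (dbase F) = dbase (projC F).
Proof. by rewrite (dualC_projP H F).1. Qed.

(** The prescribed value on [d +W d'] depends only on the sum: another decomposition changes the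
    summands by core elements adding up to 0, and [F] and [F'] induce the same functional on the
    core. *)
Lemma dualC_addP (F F' : dual V) : projC F = projC F' ->
  [/\ dbase (addC F F') = vadd VS (dbase F) (dbase F'),
      projC (addC F F') = projC F &
      forall d d', pV d = dbase F -> pV d' = dbase F' -> pW d = pW d' ->
        dual_pair (addC F F') (d +W d') = dual_pair F d + dual_pair F' d'].
Proof.
move=> FF'; rewrite /dualC_add; set Q := (X in the _ X).
apply: (@theP _ _ Q); rewrite {}/Q; set a := dbase F; set a' := dbase F'; pose k := projC F.
have am : vproj VS a = dbase k by exact: dbase_projC.
have a'm : vproj VS a' = dbase k by rewrite /k FF'; exact: dbase_projC.
have am' : vproj VS (vadd VS a a') = dbase k by rewrite (vprojD hVS) ?am.
pose P e r := exists d d', [/\ pV d = a, pV d' = a', pW d = pW d',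
  e = d +W d' & r = dual_pair F d + dual_pair F' d'].
have [||||||G Ga GP] := @dual_of_graph R T S V (vadd VS a a') P.
- by move=> x y xa ya; rewrite (vprojD hV) ?xa.
- by move=> t x xa; rewrite (vprojZ hV).
(* Any [d] over [a] and over the [W]-projection of [e] gives a decomposition; the other summand is
   the [W]-difference. *)
- move=> e ea; have [|d da de] := over_surj H (a := a) (b := pW e).
    by rewrite -(proj_proj lV) ea am'.
  have d'W : pW (vsub W e d) = pW d by rewrite (vprojB hW).
  exists (dual_pair F d + dual_pair F' (vsub W e d)), d, (vsub W e d).
  split=> //; last by rewrite (vaddC hW) ?(vsubK hW).
  apply: (vaddIr hVS (x := a)).
  + rewrite -da (proj_proj lV) d'W -(proj_proj lV) da am//.
  + by rewrite am a'm.
  by rewrite -{1}da -(proj_add lV)// (vsubK hW)// ea (vaddC hVS)// am.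
- move=> e r r' ea [d [d' [da da' dd' de ->]]] [f [f' [fa fa' ff' fe ->]]].
  have dW : pW d = pW e by rewrite de (vprojD hW).
  have fW : pW f = pW e by rewrite fe (vprojD hW).
  have [||c [cm dc _]] := core_decomp H (d := d) (d' := f); [congruence..|].
  have [||c' [cm' dc' _]] := core_decomp H (d := d') (d' := f'); [congruence..|].
  rewrite da am in cm; rewrite da' a'm in cm'.
  rewrite da in dc; rewrite da' in dc'.
  have [cV cW] := core_addP H (etrans cm (esym am)).
  have [cV' cW'] := core_addP H (etrans cm' (esym a'm)).
  have zW : pW (vzero V a) = vzero VS' (dbase k) by rewrite (proj_zero lW) am.
  have zW' : pW (vzero V a') = vzero VS' (dbase k) by rewrite (proj_zero lW) a'm.
  have cc'W : pW (incl c +W vzero V a) = pW (incl c' +W vzero V a').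
    by rewrite cW cW' am a'm.
  have zz' : pW (vzero V a) = pW (vzero V a') by rewrite zW zW'.
  have cc' : dual_pair k c + dual_pair k c' = 0.
    rewrite -dual_pairD//; apply: (dual_core0 H).
      by rewrite (core_vprojD H) ?cm.
    rewrite (incl_addW hK) ?cm// (zeroVW H).
    have z1 : pW (incl c +W incl c') = vzero VS' (dbase k).
      by rewrite (vprojD hW) !(incl_projW hK) ?cm ?cm'.
    (* After adding these zeros over [W], and then [f +W f'] over [V], the claim becomes the
       equality of the two decompositions of [e]. *)
    apply: (vaddIr hW (x := vzero V a +W vzero V a')).
    + by rewrite z1 (vprojD hW) ?zW.
    + by rewrite (vproj0 hW) (vprojD hW) ?zW.
    rewrite (vaddACA hW) ?(incl_projW hK) ?cm ?cm' ?zW ?zW'//.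
    rewrite (vadd0l hW); last by rewrite (vprojD hW) ?zW.
    apply: (vaddIl hV (x := f +W f')).
    + by rewrite (proj_add lV ff') (proj_add lV cc'W) cV cV' fa fa'.
    + by rewrite (proj_add lV ff') (proj_add lV zz') !(vproj0 hV) fa fa'.
    rewrite (add_interchange lV) ?cV ?cV' ?cW ?cW' ?am ?a'm// -dc -dc' -de fe.
    by rewrite (add_interchange lV) ?(vproj0 hV) ?zW ?zW' ?(vadd0r hV).
  rewrite dc dc' !(dual_pair_core H) -/a -/a' ?am ?a'm// -FF' -/k.
  by rewrite addrACA cc' addr0.
- move=> x y r r' xa ya [d [d' [da da' dd' xd ->]]] [f [f' [fa fa' ff' yf ->]]].
  exists (d +V f), (d' +V f'); split.
  + by rewrite (vprojD hV) ?da.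
  + by rewrite (vprojD hV) ?da'.
  + by rewrite !(proj_add lW) ?da ?da' ?dd' ?ff'.
  + by rewrite xd yf (add_interchange lV) ?da ?da'.
  + by rewrite !dual_pairD// addrACA.
- move=> t x r xa [d [d' [da da' dd' xd ->]]].
  exists (vscale V t d), (vscale V t d'); rewrite !(vprojZ hV).
  split=> //.
  + by rewrite !(proj_scale lW) dd'.
  + by rewrite xd (scale_add lV).
  + by rewrite !dual_pairZ// mulrDr.
exists G; split=> //.
  apply: (dualC_projE H); rewrite Ga ?am'// => c cm.
  have [cV cW] := core_addP H (etrans cm (esym am)).
  have [cV' cW'] := core_addP H (etrans cm (esym am')).
  rewrite (GP _ (dual_pair k c)) ?cV'//.
  (* The whole core element is placed in the first summand, so that [F'] is evaluated at a zero. *)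
  exists (incl c +W vzero V a), (vzero V a'); split.
  - by [].
  - by rewrite (vproj0 hV).
  - by rewrite cW (proj_zero lW) am a'm.
  - rewrite (zero_add lV) ?am ?a'm// (vaddA hW) ?(incl_projW hK) ?cm ?(proj_zero lW) ?am ?a'm//.
  rewrite (dual_pair0 hV)// addr0 /k (dualC_projP H F).2//.
  by rewrite cm am.
move=> d d' da da' dd'; apply: GP; last by exists d, d'.
by rewrite (proj_add lV) ?da ?da'.
Qed.

(** For nonzero [t] the functional is found by undoing the [W]-scaling before pairing with [F]. For
    [t = 0] it is the zero over the projection of [F]. *)
Lemma dualC_scaleP t (F : dual V) :
  [/\ dbase (scaleC t F) = vscale VS t (dbase F),
      projC (scaleC t F) = projC F &
      forall d, pV d = dbase F ->
        dual_pair (scaleC t F) (vscale W t d) = t * dual_pair F d].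
Proof.
rewrite /dualC_scale; set Q := (X in the _ X).
apply: (@theP _ _ Q); rewrite {}/Q; set a := dbase F; pose k := projC F.
have am : vproj VS a = dbase k by exact: dbase_projC.
have [->|t0] := eqVneq t 0.
  have [G [Gb Gk G0]] := dual_of_lift H k (linear_lift_zero (double_vector_fibres_sym H)).
  exists G; split=> //; first by rewrite (vscale0l hVS) am.
  by move=> d da; rewrite (vscale0l hW) mul0r G0// -(proj_proj lV) da.
have tK d : vscale W t^-1 (vscale W t d) = d.
  by rewrite (vscaleA hW) mulVf// (vscale1 hW).
have ta x : pV x = vscale VS t a -> pV (vscale W t^-1 x) = a.
  by move=> xa; rewrite (proj_scale lV) xa (vscaleA hVS) mulVf// (vscale1 hVS).
have [||G Ga GP] := dual_of_linear hV (n := vscale VS t a)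
    (f := fun e => t * dual_pair F (vscale W t^-1 e)).
- by move=> x y xa ya; rewrite (scale_add lW) ?xa// dual_pairD ?ta// mulrDr.
- by move=> s x xa; rewrite -(scale_scale lV) dual_pairZ ?ta// mulrCA.
exists G; split=> //; last first.
  by move=> d da; rewrite GP ?tK// (proj_scale lV) da.
have am' : vproj VS (vscale VS t a) = dbase k by rewrite (vprojZ hVS).
apply: (dualC_projE H); rewrite Ga ?am'// => c cm.
rewrite GP; last by rewrite (core_addP H _).1 ?am'.
(* The factor [t] in front cancels against the inverse scaling of the core element. *)
rewrite (zero_scale lV) (vscaleDr hW) ?tK; last first.
  by rewrite (vprojZ hW) (proj_zero lW) (incl_projW hK) cm am.
rewrite -(incl_scaleW hK) -(dualC_projP H F).2; last by rewrite (core_vprojZ H) cm am.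
by rewrite -/k dual_pairZ ?cm// mulrA mulfV// mul1r.
Qed.

(** Over a fixed [k] all values of [s] involved lie over the same point [Y (dbase k)], so the
    defining rule for addition over the dual of the core applies to them. *)
Lemma squarecapP (s : S -> T) (Y : M -> S') (k : dual VK) :
  linear_lift V W VS s Y ->
  dbase (@squarecap R T S S' K M V W VS VS' VK incl s k) = k /\
  forall F, projC F = k ->
    dual_pair (@squarecap R T S S' K M V W VS VS' VK incl s k) F = dual_pair F (s (dbase F)).
Proof.
move=> [sV sW sD sZ].
rewrite /squarecap; set Q := (X in the _ X).
apply: (@theP _ _ Q); rewrite {}/Q.
have [||||||G Gk GP] := @dual_of_graph R (dual V) (dual VK) dualC k
   (fun F r => r = dual_pair F (s (dbase F))).
- by move=> F F' /= Fk F'k; have [|_ -> _] := @dualC_addP F F'; rewrite Fk ?F'k.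
- by move=> t F /= Fk; have [_ -> _] := dualC_scaleP t F.
- by move=> F _; eexists.
- by move=> F r r' _ -> ->.
- move=> F F' r r' /= Fk F'k -> ->.
  have [|E1 _ E2] := @dualC_addP F F'; first by rewrite F'k.
  have FF' : vproj VS (dbase F) = vproj VS (dbase F') by rewrite !dbase_projC Fk F'k.
  by rewrite E1 sD// E2// !sW FF'.
- move=> t F r /= Fk ->; have [E1 _ E2] := dualC_scaleP t F.
  by rewrite E1 sZ E2.
by exists G; split=> // F Fk; apply: GP.
Qed.

End DualOperations.

(** * The map R^D_A and the pairing over the dual of the core *)

Lemma structure_morphisms_linear (R : realType) (M A B D : charted R)
    (vA : vbstr R A M) (vB : vbstr R B M) (vDA : vbstr R D A) (vDB : vbstr R D B) :
  structure_morphisms vA vB vDA vDB -> structure_morphisms vB vA vDB vDA ->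
  structure_linear vDA vDB vA vB.
Proof.
move=> [[_ _ p1 p2 p3] [_ _ a1 a2 a3] s [_ _ z1 z2 z3]] [_ _ _ [_ _ z _ _]].
split.
- by move=> d; apply: p1.
- by move=> d d' h; apply: p2.
- by move=> t d; apply: p3.
- by move=> b; apply: z.
- move=> d1 d2 e1 e2 h1 h2 h3 h4.
  by apply: (a2 (d1, d2) (e1, e2)) => //=; rewrite h3 h4.
- by move=> t d d' h; case: (s t) => _ _ _ + _; apply.
- by move=> u t d; case: (s u) => _ _ _ _; apply.
- by move=> a a' h; apply: z2.
- by move=> t a; apply: z3.
Qed.

Lemma linear_section_lift (R : realType) (T S S' M : charted R)
    (VS : vbstr R S M) (VS' : vbstr R S' M) (W : vbstr R T S) (V : vbstr R T S')
    (s : S' -> T) (X : M -> S) :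
  linear_section VS VS' W V s X -> linear_lift V W VS' s X.
Proof.
move=> [_ [_ sV] [_ _ sW sD sZ]]; split=> //.
- by move=> b; apply: sW.
- by move=> b b'; apply: sD.
- by move=> t b; apply: sZ.
Qed.

(** * The core, the warp and the value of [RDA] on a squarecap section *)

Section DVB.
Variables (R : realType) (D : double_vector_bundle R).
Notation vA := (vA D).
Notation vB := (vB D).
Notation vDA := (vDA D).
Notation vDB := (vDB D).

Lemma corePA (c : core D) :
  vproj vDA (val c) = vzero vA (vproj (core_vb D) c) /\
  vproj vDB (val c) = vzero vB (vproj (core_vb D) c).
Proof.
case: (dvb_bundles D) => -[hA _ _] _ _ _.
by case: c => d /= /asboolP[m [dA dB]]; rewrite dA (vproj0 hA).
Qed.

(** The core carries the structure of [vDA] by definition; agreement with [vDB] is Eckmann-Hilton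
    for sums and [vscale_coincide] for scalar multiples. *)
Lemma core_fibres : core_inclusion vDA vDB vA vB (core_vb D) val.
Proof.
have [bA bB bDA bDB] := dvb_bundles D.
have [[hA _ _] [hB _ _]] := (bA, bB); have [[hDA _ _] [hDB _ _]] := (bDA, bDB).
have lA := structure_morphisms_linear (dvb_morphismsA D) (dvb_morphismsB D).
have lB := structure_morphisms_linear (dvb_morphismsB D) (dvb_morphismsA D).
pose S m := [set d | vproj vDA d = vzero vA m /\ vproj vDB d = vzero vB m].
have S_core m d : S m d -> core_pred d by exists m.
have Sc c : S (vproj (core_vb D) c) (val c) by exact: corePA.
have SD m d d' : S m d -> S m d' -> S m (vadd vDA d d').
  move=> [dA dB] [d'A d'B]; split; first by rewrite (vprojD hDA) ?dA.
  by rewrite (proj_add lB) ?dA// dB d'B (vadd0l hB)// (vproj0 hB).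
have SZ m t d : S m d -> S m (vscale vDA t d).
  move=> [dA dB]; split; first by rewrite (vprojZ hDA).
  by rewrite (proj_scale lB) dB (vscale0r hB).
have zAB m : vzero vDA (vzero vA m) = vzero vDB (vzero vB m).
  have zz : vscale vA 0 (vzero vA m) = vzero vA m by exact: vscale0r.
  by rewrite -[in LHS]zz (zero_scale lA) (vscale0l hDB) (proj_zero lB) (vproj0 hA).
(* Eckmann-Hilton *)
have addAB m d d' : S m d -> S m d' -> vadd vDA d d' = vadd vDB d d'.
  move=> [dA dB] [d'A d'B].
  have z := zAB m.
  rewrite -{1}(vadd0r hDB dB) -{1}(vadd0l hDB d'B) (add_interchange lA).
  - by rewrite -z (vadd0r hDA)// (vadd0l hDA).
  - by rewrite dA -z (vproj0 hDA).
  - by rewrite d'A -z (vproj0 hDA).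
  - by rewrite dB (vproj0 hDB).
  - by rewrite d'B (vproj0 hDB).
have scaleAB m d t : S m d -> vscale vDA t d = vscale vDB t d.
  move=> Sd; have [_ _ _ [hausD _ _ _ _]] := dvb_manifolds D.
  apply: (@vscale_coincide R (dvbD D) _ _ vDA vDB d (S m) (vzero vB m)) => //.
  - by move=> s x; apply: SZ.
  - by move=> x [].
  - by move=> x y; apply: addAB.
  - by move=> x [xA xB]; rewrite (vscale0l hDA) (vscale0l hDB) xA xB.
have valD c c' : vproj (core_vb D) c = vproj (core_vb D) c' ->
    val (vadd (core_vb D) c c') = vadd vDA (val c) (val c').
  (* The sum is again in the core, so [insubd] does not use its default. *)
  move=> cc'; rewrite /= val_insubd ifT//; apply/asboolP.
  by apply: S_core (SD _ _ _ (Sc c) _); rewrite cc'; exact: Sc.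
have valZ t c : val (vscale (core_vb D) t c) = vscale vDA t (val c).
  rewrite /= val_insubd ifT//; apply/asboolP.
  exact: S_core (SZ _ _ _ (Sc c)).
split=> //; try by move=> c; case: (Sc c).
- move=> m d dA dB; have hd : `[< core_pred d >] by apply/asboolP; exists m.
  by exists (Sub d hd : core D) => //=; rewrite dA (vproj0 hA).
- move=> c c' cc'; rewrite valD// (addAB _ _ _ (Sc c))// cc'; exact: Sc.
- by move=> t c; rewrite valZ (scaleAB _ _ _ (Sc c)).
Qed.

Lemma dvb_fibres : double_vector_fibres vDA vDB vA vB (core_vb D) val.
Proof.
have [[hA _ _] [hB _ _] [hDA _ _] [hDB _ _]] := dvb_bundles D.
split=> //.
- exact: structure_morphisms_linear (dvb_morphismsA D) (dvb_morphismsB D).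
- exact: structure_morphisms_linear (dvb_morphismsB D) (dvb_morphismsA D).
- move=> a b ab; have [surj _] := dvb_submersion D.
  by have [d [da db]] := surj _ _ ab; exists d.
- exact: core_fibres.
Qed.

Let H := dvb_fibres.
Let H' := double_vector_fibres_sym H.
Let hDA := fibresV H.
Let hDB := fibresW H.
Let lA := linearV H.
Let lB := linearW H.

(** The core difference of the two grid elements is a witness for the definition. Only the equation
    for subtraction over [B] is kept, as it is the one to pair with elements of [DstarB]. *)
Lemma warpP xi X eta Y (m : dvbM D) :
  linear_section_over_B xi X -> linear_section_over_A eta Y ->
  vproj (core_vb D) (warp xi X eta Y m) = m /\
  vsub vDB (xi (Y m)) (eta (X m)) =
    vadd vDA (val (warp xi X eta Y m)) (vzero vDB (Y m)).
Proof.
move=> hxi heta; have [[_ Xm] _ _] := hxi; have [[_ Ym] _ _] := heta.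
have [xB xA _ _] := linear_section_lift hxi.
have [eA eB _ _] := linear_section_lift heta.
have xiA : vproj vDA (xi (Y m)) = X m by rewrite xA Ym.
have etaB : vproj vDB (eta (X m)) = Y m by rewrite eB Xm.
suff [] : [/\ vproj (core_vb D) (warp xi X eta Y m) = m,
  vsub vDA (xi (Y m)) (eta (X m)) =
    vadd vDB (val (warp xi X eta Y m)) (vzero vDA (X m)) &
  vsub vDB (xi (Y m)) (eta (X m)) =
    vadd vDA (val (warp xi X eta Y m)) (vzero vDB (Y m))] by [].
rewrite /warp; set Q := (X in the _ X); apply: (@theP _ _ Q).
have [||c [cm cA cB]] := core_difference H (d := xi (Y m)) (d' := eta (X m)).
- by rewrite xiA eA.
- by rewrite xB etaB.
exists c; split.
- by rewrite cm xiA Xm.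
- by rewrite cA xiA.
- by rewrite cB xB.
Qed.

(** The functional from [dual_of_lift] shows that [the] finds a solution. The rest is derived from
    the characterization alone, and thus holds for whichever solution is chosen. *)
Lemma RDA_squarecap xi X (k : Cstar D) : linear_section_over_B xi X ->
  [/\ dbase (RDA (squarecapB xi k)) = X (dbase k),
      vproj (vDstarA D) (RDA (squarecapB xi k)) = k &
      forall (G : DstarB D) d, vproj (vDstarB D) G = k ->
        vproj vDA d = X (dbase k) -> vproj vDB d = dbase G ->
        dual_pair (RDA (squarecapB xi k)) d = dual_pair G d - dual_pair G (xi (dbase G))].
Proof.
move=> hxi; have [[_ Xm] _ _] := hxi; have hl := linear_section_lift hxi.
have [xB xA xD xZ] := hl; set m := dbase k.
have [bk bP] := squarecapP H' k hl; rewrite -/(squarecapB xi k) in bk bP.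
set b := squarecapB xi k in bk bP *.
set F := RDA b.
have dmB d : vproj vDA d = X m -> vproj vB (vproj vDB d) = m.
  by rewrite -(proj_proj lA) => ->; rewrite Xm.
have [Fk FP] : vproj (vDstarA D) F = k /\ forall (G : DstarB D) (d : dvbD D),
    vproj (vDstarB D) G = k -> vproj vDA d = dbase F -> vproj vDB d = dbase G ->
    dual_pair b G + dual_pair F d = dual_pair G d.
  rewrite -[in RHS]bk.
  rewrite {}/F /RDA; set Q := (X in the _ X).
  have : Q (the (dual_zero vDA (vzero vA (dbase (dbase b)))) Q); last first.
    by rewrite {1}/Q /= !bk.
  apply: theP; rewrite {}/Q.
  have [F [Fa Fk F0]] := dual_of_lift H k hl.
  exists F; split; rewrite bk// => G d Gk dF dG.
  rewrite bP// -dG; rewrite Fa in dF.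
  have xiX : vproj vDA (xi (vproj vDB d)) = X m by rewrite xA dmB.
  (* One core element [c] measures [d] against [xi] in both structures: [F] gives [dual_pair k c] on
     [d], and [G] gives the same amount on top of its value on [xi]. *)
  have [||c [cm cA cB]] := core_decomp H (d := d) (d' := xi (vproj vDB d)).
  - by rewrite dF xiX.
  - by rewrite xB.
  rewrite dF Xm in cm; rewrite dF -Fa in cA; rewrite dG in cB.
  have Fm : vproj vA (dbase F) = m by rewrite Fa Xm.
  have Gm : vproj vB (dbase G) = m by rewrite -dG dmB.
  have -> : dual_pair F d = dual_pair k c.
    by rewrite cA (dual_pair_core H) ?Fm ?Fa// Fk F0 ?add0r// dmB.
  rewrite dG [in RHS]cB (dual_pair_core H') ?xB ?Gm//.
  by rewrite [dualC_proj _ _ _ _ G]Gk.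
have Fm : vproj vA (dbase F) = m by rewrite (dbase_projC H) [dualC_proj _ _ _ _ F]Fk.
have Fa : dbase F = X m.
  have [bA _ _ _] := dvb_bundles D.
  apply: (dual_separates bA); rewrite ?Xm// Fm => al alm.
  (* [G0] is the zero over [k] in [DstarB]. Adding the core element given by the functional [al] on
     [A] yields [G1], still over [k], whose value on the zero over [a] is [al] at [a]. *)
  have [G0 [Gb Gk G00]] := dual_of_lift H' k (linear_lift_zero H).
  have nA d : vproj vDB d = vzero vB m -> vproj vA (vproj vDA d) = m.
    by rewrite (proj_proj lA) => ->; rewrite (vproj0 (fibresVS' H)).
  have [||G1 G1b G1P] := dual_of_linear hDB (n := vzero vB m)
    (f := fun d => dual_pair G0 d + dual_pair al (vproj vDA d)).
  - move=> d d' dz d'z; rewrite (proj_add lA) ?dz// dual_pairD ?Gb//.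
    by rewrite dual_pairD ?alm ?nA// addrACA.
  - move=> t d dz; rewrite (proj_scale lA) dual_pairZ ?Gb//.
    by rewrite dual_pairZ ?alm ?nA// mulrDr.
  have vBm : vproj vB (vzero vB m) = m by exact: (vproj0 (fibresVS' H)).
  have G1k : vproj (vDstarB D) G1 = k.
    apply: (dualC_projE H'); rewrite G1b ?vBm// => c cm.
    have [cB cA] := core_addP H' (etrans cm (esym vBm)).
    rewrite G1P// cA vBm (dual_pair0 (fibresVS H))// addr0.
    by rewrite -Gb -(dualC_projP H' G0).2 ?Gb ?vBm// Gk.
  have G1z a : vproj vA a = m -> dual_pair G1 (vzero vDA a) = dual_pair al a.
    by move=> am; rewrite G1P ?(proj_zero lB) ?am// (vproj0 hDA) G00// add0r.
  have xi0 : xi (vzero vB m) = vzero vDA (X m).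
    rewrite -{1}(vscale0r (fibresVS' H) 0) xZ (vscale0l hDA) xA.
    by rewrite (vproj0 (fibresVS' H)).
  (* Here the pairing with [F] vanishes, so the characterization compares [al] at [X m] with [al] at
     [dbase F]. *)
  have := FP G1 (vzero vDA (dbase F)) G1k.
  rewrite (vproj0 hDA) (proj_zero lB) Fm G1b => /(_ erefl erefl).
  by rewrite bP// G1b xi0 !G1z ?Xm// (dual_pair0 hDA)// addr0.
split=> // G d Gk dX dG; apply/eqP.
by rewrite eq_sym subr_eq -(bP _ Gk) addrC FP ?Fa.
Qed.

Lemma squarecap_pairing xi X eta Y (k : Cstar D) :
  linear_section_over_B xi X -> linear_section_over_A eta Y ->
  pairingC (squarecapB xi k) (squarecapA eta k) =
  - dual_pair k (warp xi X eta Y (dbase k)).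
Proof.
move=> hxi heta; set m := dbase k; have [wm wB] := warpP m hxi heta.
have [[_ Xm] _ _] := hxi; have [[_ Ym] _ _] := heta.
have [xB xA _ _] := linear_section_lift hxi.
have hl := linear_section_lift heta; have [eA eB _ _] := hl.
have [Fa Fk FP] := RDA_squarecap k hxi.
rewrite /pairingC (squarecapP H k hl).2// Fa -/m.
(* eta also yields an element of D^{*B} over (Y m, k), to test R^D_A against *)
have [G [Gb Gk _]] := dual_of_lift H' k hl.
rewrite (FP G) ?Gb ?eA ?eB ?Xm// -/m.
(* The warp equation solved for [xi (Y m)]: the values of [G] on [xi] and on [eta] then differ by
   the pairing of [k] with the warp. *)
have xE : xi (Y m) = vadd vDB (eta (X m)) (vadd vDA (val (warp xi X eta Y m)) (vzero vDB (dbase G))).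
  by rewrite Gb -wB (vaddC hDB) ?(vsubK hDB) ?(vprojB hDB) ?xB ?eB ?Xm.
rewrite xE (dual_pair_core H') ?Gb ?eB ?Xm ?Ym// Gk.
by rewrite opprD addNKr.
Qed.

End DVB.

Theorem theorem5p2 (R : realType) (D : double_vector_bundle R)
    (X : dvbM D -> dvbA D) (xi : dvbB D -> dvbD D)
    (Y : dvbM D -> dvbB D) (eta : dvbA D -> dvbD D)
    (hxi : linear_section_over_B xi X) (heta : linear_section_over_A eta Y) :
  let w := warp xi X eta Y in
  (fun k : Cstar D => pairingC (squarecapB xi k) (squarecapA eta k))
    = ell (fun m => vopp (core_vb D) (w m)) /\
  (forall (m : dvbM D) (k : Cstar D), dbase k = m ->
     pairingC (squarecapB xi k) (squarecapA eta k) = - dual_pair k (w m)).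
Proof.
move=> w; split; last by move=> m k <-; exact: squarecap_pairing.
apply/funext => k; rewrite /ell dual_pairN; first exact: squarecap_pairing.
exact: (warpP _ hxi heta).1.
Qed.
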